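(* Let $G$ be a connected finite simple graph with $n$ vertices and $m$ edges, without isolated vertices, and with vertex bipartiteness $\upsilon_b(G)$. Then $$s_Q(G)\ \ge\ \frac{4m}{n}-\upsilon_b(G).$$ Equality holds if $G$ is a regular bipartite graph.
   Context: For a finite simple graph $G$ on $n$ vertices, let $A_G$ be its adjacency matrix and $D_G$ the diagonal matrix of vertex degrees. The signless Laplacian matrix is $Q_G=D_G+A_G$ with eigenvalues $q_1\ge q_2\ge\cdots\ge q_n$, and the signless Laplacian spread is $s_Q(G)=q_1-q_n$. The vertex bipartiteness $\upsilon_b(G)$ is the minimum number of vertices of $G$ whose deletion yields a bipartite graph (so $\upsilon_b(G)=0$ if $G$ is bipartite). *)

(* Defs.v *)
From HB Require Import structures.
From mathcomp Require Export all_boot all_order all_algebra.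
From mathcomp Require Export polyrcf.

Set Implicit Arguments.
Unset Strict Implicit.
Unset Printing Implicit Defensive.

Import Order.TTheory GRing.Theory Num.Theory.
Local Open Scope ring_scope.

Record sgraph (V : finType) := SGraph {
  adj :> rel V;
  adj_sym : symmetric adj;
  adj_irrefl : irreflexive adj
}.

Section Graph.
Variables (V : finType) (G : sgraph V).

Definition edges : {set {set V}} :=
  [set [set p.1; p.2] | p : V * V & G p.1 p.2].

Definition degree (x : V) : nat := #|[set y | G x y]|.

Definition connected_graph : Prop :=
  (0 < #|V|)%N /\ forall x y : V, connect G x y.

Definition no_isolated : Prop := forall x : V, (0 < degree x)%N.

Definition regular : Prop := exists d : nat, forall x : V, degree x = d.

Definition bipartite : bool :=
  [exists c : {ffun V -> bool}, [forall x, forall y, G x y ==> (c x != c y)]].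

(* The graph G - S, on the subtype of the vertices outside S. *)
Definition delete (S : {set V}) : sgraph {x : V | x \notin S} :=
  @SGraph {x : V | x \notin S} (fun x y => G (val x) (val y))
    (fun x y => adj_sym G (val x) (val y))
    (fun x => adj_irrefl G (val x)).

End Graph.

(* The default setT of the arg min is admissible: deleting every vertex leaves
   the empty graph, which is bipartite (delete_all_bipartite). *)
Definition vertex_bipartiteness (V : finType) (G : sgraph V) : nat :=
  #|[arg min_(S < [set: V] | bipartite (delete G S)) #|S|]%N|.

Lemma delete_all_bipartite (V : finType) (G : sgraph V) :
  bipartite (delete G [set: V]).
Proof.
apply/existsP; exists [ffun=> true]; apply/forallP => -[x xN].
by exfalso; move: xN; rewrite inE.
Qed.

Lemma vertex_bipartitenessP (V : finType) (G : sgraph V) :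
  (exists2 S : {set V},
     bipartite (delete G S) & #|S| = vertex_bipartiteness G) /\
  (forall S : {set V},
     bipartite (delete G S) -> (vertex_bipartiteness G <= #|S|)%N).
Proof.
rewrite /vertex_bipartiteness.
by case: arg_minnP => [|S bS minS]; [exact: delete_all_bipartite | split; [exists S|]].
Qed.

Section Spectrum.
Variable R : rcfType.

(* The real roots of the characteristic polynomial, each repeated according to
   its algebraic multiplicity, in nonincreasing order.  For a real symmetric
   matrix of order n, whose characteristic polynomial splits, this list has
   length n; eigenvaluesP identifies it with any given splitting. *)
Definition eigenvalues n (A : 'M[R]_n) : seq R :=
  sort >=%R (flatten [seq nseq (mup x (char_poly A)) x
                     | x <- rootsR (char_poly A)]).

Lemma eigenvaluesP n (A : 'M[R]_n) (s : seq R) :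
  char_poly A = \prod_(x <- s) ('X - x%:P) -> perm_eq (eigenvalues A) s.
Proof.
move=> Es; rewrite /eigenvalues perm_sort.
have p0 : char_poly A != 0 by rewrite monic_neq0 ?char_poly_monic.
have rootE y : (y \in rootsR (char_poly A)) = root (char_poly A) y.
  by rewrite -(roots_on_rootsR p0) in_itv.
apply/allP => y _; apply/eqP => /=.
rewrite -[RHS]mu_prod_XsubC -Es count_flatten -map_comp sumnE big_map.
transitivity (\sum_(x <- rootsR (char_poly A) | x == y) mup x (char_poly A))%N.
  rewrite [RHS]big_mkcond; apply: eq_bigr => x _ /=.
  by rewrite count_nseq /=; case: eqP; rewrite ?mul1n.
case: (boolP (root (char_poly A) y)) => [ry | Nry].
  by rewrite -big_filter filter_pred1_uniq ?rootE ?uniq_roots ?big_seq1.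
rewrite (mupNroot Nry) big_seq_cond big1 // => x /andP[xr /eqP xy].
by rewrite -xy -rootE xr in Nry.
Qed.

Definition adjacency_mx n (G : sgraph 'I_n) : 'M[R]_n :=
  \matrix_(i, j) (G i j)%:R.

Definition degree_mx n (G : sgraph 'I_n) : 'M[R]_n :=
  diag_mx (\row_i (degree G i)%:R).

Definition signless_laplacian n (G : sgraph 'I_n) : 'M[R]_n :=
  degree_mx G + adjacency_mx G.

(* Index i : nat stands for q_(i+1) in the usual 1-based numbering q_1 >= ... >= q_n. *)
Definition signless_eigenvalue n (G : sgraph 'I_n) (i : nat) : R :=
  (eigenvalues (signless_laplacian G))`_i.

Definition signless_spread n (G : sgraph 'I_n) : R :=
  signless_eigenvalue G 0 - signless_eigenvalue G n.-1.

End Spectrum.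

(* Main.v *)
(* The spectral theorem turns x Q x^T into a nonnegative combination of the
   eigenvalues of total weight x x^T, hence q_n |x|^2 <= x Q x^T <= q_1 |x|^2.
   Since x Q x^T is the sum of (x_i + x_j)^2 over the edges, the all-ones vector
   gives q_1 >= 4m/n.  If deleting S leaves a bipartite graph, the vector that
   vanishes on S and is the +-1 colouring elsewhere only sees the edges between
   S and its complement, at most |S|(n - |S|) in number, so q_n <= |S|.  For a
   d-regular bipartite graph, 0 <= x Q x^T <= 2 d |x|^2 gives equality. *)
Require Import Defs.
From mathcomp Require Import all_boot all_order all_algebra.
From mathcomp Require Import complex spectral ring lra.

Set Implicit Arguments.
Unset Strict Implicit.
Unset Printing Implicit Defensive.

Import Order.TTheory GRing.Theory Num.Theory Num.Def.
Local Open Scope ring_scope.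

(** * Spectral theorem for real symmetric matrices *)

Lemma char_poly_conj (F : fieldType) n (P D : 'M[F]_n) :
  P \in unitmx -> char_poly (invmx P *m D *m P) = char_poly D.
Proof.
move=> Pu; have Pu' : \det (map_mx polyC P) != 0.
  by rewrite det_map_mx polyC_eq0 -unitfE -unitmxE.
apply: (mulfI Pu'); rewrite [RHS]mulrC /char_poly -!det_mulmx.
congr (\det _); rewrite /char_poly_mx mulmxBr mulmxBl -scalar_mxC.
by rewrite -!map_mxM !mulmxA mulmxV // mul1mx.
Qed.

(** Over [R[i]] the matrix becomes Hermitian, hence unitarily diagonalisable with real diagonal. The
    weights of [x] are the squared moduli of its coordinates in the eigenbasis; both claims descend
    to [R] by injectivity of the embedding. *)
Lemma symmetric_spectral_weights (R : rcfType) n (A : 'M[R]_n) : A^T = A ->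
  exists2 r : 'I_n -> R,
      char_poly A = \prod_(x <- [seq r i | i : 'I_n]) ('X - x%:P) &
    forall x : 'rV[R]_n, exists w : 'I_n -> R,
      [/\ forall i, 0 <= w i, (x *m x^T) 0 0 = \sum_i w i
        & (x *m A *m x^T) 0 0 = \sum_i w i * r i].
Proof.
move=> Asym; pose B := map_mx (real_complex R) A.
have Bh : B \is hermsymmx.
  apply/is_hermitianmxP; rewrite expr0 scale1r; apply/matrixP => i j.
  by rewrite !mxE -{1}Asym mxE; symmetry; apply/CrealP; rewrite complex_real.
pose P := spectralmx B; pose d := spectral_diag B.
have dr i : d 0 i = real_complex R (complex.Re (d 0 i)).
  by rewrite RRe_real //; apply/mxOverP/hermitian_spectral_diag_real.
have BE : B = invmx P *m diag_mx d *m P.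
  by apply/orthomx_spectralP/hermitian_normalmx.
have Puni : P \is unitarymx by apply: spectral_unitarymx.
exists (fun i => complex.Re (d 0 i)); rewrite ?big_image.
  apply: (map_inj_poly (@complexI R) (rmorph0 _)).
  rewrite map_char_poly -/B BE char_poly_conj ?spectral_unit //.
  rewrite char_poly_trig ?diag_mx_is_trig // rmorph_prod.
  apply: eq_bigr => i _.
  by rewrite rmorphB /= map_polyX map_polyC /= -dr mxE eqxx mulr1n.
move=> x; pose z := map_mx (real_complex R) x; pose y := z *m invmx P.
exists (fun i => complex.Re (`|y 0 i| ^+ 2)).
have wE i : (complex.Re (`|y 0 i| ^+ 2))%:C%C = y 0 i * conjC (y 0 i).
  by rewrite -normCK RRe_real // rpredX // normr_real.
have xT : map_mx (real_complex R) x^T = (map_mx conjC z)^T.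
  by apply/matrixP => i j; rewrite !mxE; apply/esym/CrealP; rewrite complex_real.
have iP : invmx P = map_mx conjC P^T by apply: invmx_unitary.
(* Since [invmx P] is the conjugate transpose of [P], passing from [z] to [y] preserves the
   Hermitian norm and makes the form of [B] diagonal. *)
have yT : P *m (map_mx conjC z)^T = (map_mx conjC y)^T.
  rewrite map_mxM trmx_mul iP (_ : map_mx conjC (map_mx conjC P^T) = P^T) ?trmxK //.
  by apply/matrixP => i j; rewrite !mxE conjCK.
have zE : z = y *m P by rewrite /y mulmxKV // spectral_unit.
split.
- by move=> i; rewrite -ler0c wE -normCK exprn_ge0.
- apply: (@complexI R); rewrite rmorph_sum /=.
  transitivity ((map_mx (real_complex R) (x *m x^T)) 0 0); first by rewrite [RHS]mxE.
  rewrite map_mxM xT -/z {1}zE -mulmxA yT mxE; apply: eq_bigr => i _.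
  by rewrite wE !mxE.
apply: (@complexI R); rewrite rmorph_sum /=.
transitivity ((map_mx (real_complex R) (x *m A *m x^T)) 0 0); first by rewrite [RHS]mxE.
rewrite !map_mxM xT -/z -/B BE !mulmxA -/y -[_ *m P *m _]mulmxA yT mul_mx_diag mxE.
by apply: eq_bigr => i _; rewrite rmorphM /= wE -dr !mxE mulrAC.
Qed.

(** * Extreme eigenvalues and Rayleigh quotients *)

Lemma eigenvalues_bounds (R : rcfType) n (A : 'M[R]_n) (s := eigenvalues A) x :
  x \in s -> s`_(size s).-1 <= x <= s`_0.
Proof.
have ss : sorted >=%R s by apply/sort_sorted/ge_total.
move=> xs; have xi : (index x s < size s)%N by rewrite index_mem.
have ge_tr : transitive (>=%R : rel R) by move=> ? ? ? /[swap]; apply: le_trans.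
have le_nth := sorted_leq_nth ge_tr (@lexx _ R) 0 ss.
rewrite -[x in _ <= x <= _](nth_index 0 xs).
by apply/andP; split; apply: le_nth; rewrite ?inE //; case: (size s) xi.
Qed.

Lemma size_eigenvalues (R : rcfType) n (A : 'M[R]_n) :
  A^T = A -> size (eigenvalues A) = n.
Proof.
move=> /symmetric_spectral_weights[r Er _].
by rewrite (perm_size (eigenvaluesP Er)) size_map -cardE card_ord.
Qed.

Lemma rayleigh_bounds (R : rcfType) n (A : 'M[R]_n) (s := eigenvalues A) (x : 'rV_n) :
  A^T = A ->
  s`_n.-1 * (x *m x^T) 0 0 <= (x *m A *m x^T) 0 0 <= s`_0 * (x *m x^T) 0 0.
Proof.
move=> As; have sn := size_eigenvalues As.
have [r Er /(_ x)[w [w0 -> ->]]] := symmetric_spectral_weights As.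
have rs i : s`_n.-1 <= r i <= s`_0.
  rewrite -[in n.-1]sn; apply: eigenvalues_bounds.
  by rewrite (perm_mem (eigenvaluesP Er)) image_f.
rewrite !mulr_sumr; apply/andP.
split; apply: ler_sum => i _; have /andP[rl ru] := rs i.
  by rewrite mulrC; apply: ler_wpM2l.
by rewrite [leRHS]mulrC; apply: ler_wpM2l.
Qed.

Lemma eigenvalues_eigenvalue (R : rcfType) n (A : 'M[R]_n) i :
  A^T = A -> (i < n)%N -> eigenvalue A (eigenvalues A)`_i.
Proof.
move=> As ilt; rewrite eigenvalue_root_char.
have [r Er _] := symmetric_spectral_weights As.
have /(mem_nth 0) : (i < size (eigenvalues A))%N by rewrite size_eigenvalues.
by rewrite (perm_mem (eigenvaluesP Er)) Er root_prod_XsubC.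
Qed.

Lemma mulmx_trE (R : rcfType) n (x : 'rV[R]_n) : (x *m x^T) 0 0 = \sum_i x 0 i ^+ 2.
Proof. by rewrite mxE; apply: eq_bigr => i _; rewrite mxE. Qed.

(** * The quadratic form of the signless Laplacian *)

Section SignlessLaplacian.
Variables (R : rcfType) (n : nat) (G : sgraph 'I_n).
Let Q : 'M[R]_n := signless_laplacian R G.

Lemma degreeE i : (degree G i)%:R = \sum_j (G i j)%:R :> R.
Proof.
rewrite /degree -sum1_card natr_sum big_mkcond; apply: eq_bigr => j _.
by rewrite inE; case: (G i j).
Qed.

Lemma signless_laplacian_sym : Q^T = Q.
Proof.
apply/matrixP => i j; rewrite !mxE adj_sym eq_sym.
by case: eqP => [->|].
Qed.

(** The factor 2 appears because the double sum runs over ordered pairs and meets every edge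
    twice. *)
Lemma signless_formE (x : 'rV[R]_n) :
  2 * (x *m Q *m x^T) 0 0 = \sum_i \sum_j (G i j)%:R * (x 0 i + x 0 j) ^+ 2.
Proof.
have E : (x *m Q *m x^T) 0 0 =
  \sum_i \sum_j (G i j)%:R * x 0 i ^+ 2 + \sum_i \sum_j (G i j)%:R * (x 0 i * x 0 j).
  rewrite mulmxDr mulmxDl mxE mul_mx_diag; congr (_ + _).
    rewrite mxE; apply: eq_bigr => i _.
    by rewrite !mxE degreeE -mulr_suml; ring.
  rewrite mxE exchange_big; apply: eq_bigr => i _.
  by rewrite !mxE mulr_suml; apply: eq_bigr => j _; rewrite !mxE; ring.
(* Symmetry of adjacency splits the doubled degree term evenly between [x 0 i ^+ 2] and
   [x 0 j ^+ 2], completing the square. *)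
have E' : \sum_i \sum_j (G i j)%:R * x 0 i ^+ 2 = \sum_i \sum_j (G i j)%:R * x 0 j ^+ 2.
  by rewrite exchange_big; do 2!apply: eq_bigr => ? _; rewrite adj_sym.
transitivity (\sum_i \sum_j (G i j)%:R * x 0 i ^+ 2 + \sum_i \sum_j (G i j)%:R * x 0 j ^+ 2
   + 2 * \sum_i \sum_j (G i j)%:R * (x 0 i * x 0 j)).
  by rewrite E -E'; ring.
rewrite mulr_sumr -!big_split; apply: eq_bigr => i _ /=.
by rewrite mulr_sumr -!big_split; apply: eq_bigr => j _ /=; ring.
Qed.

Lemma signless_form_ge0 (x : 'rV[R]_n) : 0 <= (x *m Q *m x^T) 0 0.
Proof.
rewrite -(pmulr_rge0 _ (ltr0Sn R 1)) signless_formE.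
by do 2!apply: sumr_ge0 => ? _; rewrite mulr_ge0 ?sqr_ge0.
Qed.

(** By [(a + b)^2 <= 2 a^2 + 2 b^2], each [x 0 i ^+ 2] is counted in proportion to the degree of
    [i]. *)
Lemma signless_form_le d (x : 'rV[R]_n) : (forall i, degree G i <= d)%N ->
  (x *m Q *m x^T) 0 0 <= 2 * d%:R * (x *m x^T) 0 0.
Proof.
move=> degd; rewrite -(ler_pM2l (ltr0Sn R 1)) signless_formE mulmx_trE.
have H : \sum_i \sum_j (G i j)%:R * (x 0 i + x 0 j) ^+ 2
   <= \sum_i \sum_j (G i j)%:R * (2 * x 0 i ^+ 2) + \sum_i \sum_j (G i j)%:R * (2 * x 0 j ^+ 2).
  rewrite -big_split; apply: ler_sum => i _ /=.
  rewrite -big_split; apply: ler_sum => j _ /=.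
  by rewrite -mulrDr ler_wpM2l //; have := sqr_ge0 (x 0 i - x 0 j); nra.
apply: le_trans H _; rewrite [X in _ + X]exchange_big.
have -> : \sum_j \sum_i (G i j)%:R * (2 * x 0 j ^+ 2) = \sum_i \sum_j (G i j)%:R * (2 * x 0 i ^+ 2).
  by do 2!apply: eq_bigr => ? _; rewrite adj_sym.
have -> : forall z : R, z + z = 2 * z by move=> z; ring.
rewrite ler_pM2l // mulr_sumr; apply: ler_sum => i _.
rewrite -mulr_suml -degreeE mulrCA mulrA ler_wpM2r ?sqr_ge0 // ler_pM2l // ler_nat.
exact: degd.
Qed.

(** Ordered adjacent pairs are counted by first vertex, then by underlying edge; the fibre over an
    edge [{a, b}] is [(a, b)] and [(b, a)], distinct as there are no loops. *)
Lemma handshake : (\sum_i degree G i = 2 * #|edges G|)%N.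
Proof.
transitivity #|[pred p : 'I_n * 'I_n | G p.1 p.2]|.
  rewrite -sum1_card (eq_bigl (fun p => true && G p.1 p.2)) // -(pair_big_dep xpredT G (fun _ _ => 1%N)).
  by apply: eq_bigr => i _; rewrite sum1_card /degree cardsE.
pose e (p : 'I_n * 'I_n) := [set p.1; p.2].
rewrite -[LHS]sum1_card (partition_big e (mem (edges G))) /=; last first.
  by move=> p Gp; apply: imset_f; rewrite inE.
rewrite mulnC -sum_nat_const; apply: eq_bigr => _ /imsetP[[a b] + ->].
rewrite inE /= => Gab.
have nab : a != b by apply: contraTneq Gab => ->; rewrite adj_irrefl.
have <- : #|[set (a, b); (b, a)]| = 2%N.
  by rewrite cards2 xpair_eqE (negbTE nab).
rewrite sum1_card; apply: eq_card => -[u v]; rewrite !inE !xpair_eqE /=.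
apply/andP/orP => [[Guv /eqP Euv]|].
  have : u \in [set a; b] by rewrite -Euv set21.
  have : v \in [set a; b] by rewrite -Euv set22.
  rewrite !inE => /orP[]/eqP vE /orP[]/eqP uE; move: Guv;
    rewrite inE /= uE vE ?adj_irrefl // !eqxx => _; [by right | by left].
by case=> /andP[/eqP-> /eqP->]; rewrite inE /= /e /=; [|rewrite adj_sym setUC].
Qed.

(** * Test vector from a bipartite deletion *)

Lemma bipartite_form_le (S : {set 'I_n}) : bipartite (delete G S) ->
  exists2 x : 'rV[R]_n, (x *m x^T) 0 0 = (n - #|S|)%:R &
    (x *m Q *m x^T) 0 0 <= #|S|%:R * (n - #|S|)%:R.
Proof.
move=> /existsP[c /forallP cP].
(* [insub] fails exactly on [S], where the default 0 is taken; elsewhere the colour gives the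
   sign. *)
pose f i : R := if insub i is Some u then (-1) ^+ c u else 0.
have fS i : i \in S -> f i = 0 by move=> iS; rewrite /f insubF // iS.
have fNS i : i \notin S -> f i ^+ 2 = 1.
  by move=> iS; rewrite /f insubT sqrr_sign.
have fG i j : i \notin S -> j \notin S -> G i j -> f i + f j = 0.
  move=> iS jS Gij; rewrite /f !insubT.
  have /forallP/(_ (Sub j jS))/implyP/(_ Gij) := cP (Sub i iS).
  by move: (c (Sub i iS)) (c (Sub j jS)) => [] []; rewrite ?expr1 ?expr0 ?subrr ?addNr.
have cS : \sum_i (i \in S)%:R = #|S|%:R :> R.
  by rewrite -sum1_card natr_sum [RHS]big_mkcond; apply: eq_bigr => i _; case: (i \in S).
have cNS : \sum_i (i \notin S)%:R = (n - #|S|)%:R :> R.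
  have -> : (n - #|S|)%N = #|~: S| by rewrite [RHS]cardsCs setCK card_ord.
  rewrite -sum1_card natr_sum [RHS]big_mkcond.
  by apply: eq_bigr => i _; rewrite inE; case: (i \in S).
exists (\row_i f i).
  rewrite mulmx_trE -cNS; apply: eq_bigr => i _; rewrite mxE.
  by have [/fS->|/fNS->//] := boolP (i \in S); rewrite expr0n.
rewrite -(ler_pM2l (ltr0Sn R 1)) signless_formE.
(* An adjacent pair inside [S] contributes 0, and one outside [S] cancels by opposite signs. A pair
   with one end in [S] contributes 1; the bounding sum equals [2 |S| (n - |S|)]. *)
apply: (@le_trans _ _ (\sum_i \sum_j ((i \in S)%:R * (j \notin S)%:R + (i \notin S)%:R * (j \in S)%:R))).
  apply: ler_sum => i _; apply: ler_sum => j _; rewrite !mxE.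
  case: (boolP (G i j)) => [Gij|_]; last first.
    by rewrite mul0r addr_ge0 ?mulr_ge0.
  rewrite mul1r; case: (boolP (i \in S)) => iS; case: (boolP (j \in S)) => jS /=.
  - by rewrite !fS // addr0 expr0n !(mulr0, mul0r) addr0.
  - by rewrite fS // add0r fNS // !(mulr1, mul0r) addr0.
  - by rewrite (fS j) // addr0 fNS // !(mulr1, mul0r) add0r.
  - by rewrite fG // expr0n !(mulr0, mul0r) addr0.
under eq_bigr do rewrite big_split -!mulr_sumr cS cNS.
by rewrite big_split -!mulr_suml cS cNS /=; lra.
Qed.

(** Keeping a single vertex leaves a bipartite graph. Strictness makes [n - #|S|] positive for a
    minimum [S], so that it can be cancelled in the bound on the least eigenvalue. *)
Lemma vertex_bipartiteness_lt : (0 < n)%N -> (vertex_bipartiteness G < n)%N.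
Proof.
move=> n0; have [_ /(_ [set~ Ordinal n0])] := vertex_bipartitenessP G.
rewrite cardsC1 card_ord => H; apply: leq_ltn_trans (H _) _; last by rewrite prednK.
apply/existsP; exists [ffun=> true]; apply/forallP => -[x xv]; apply/forallP => -[y yv].
have v0 z : z \notin [set~ Ordinal n0] -> z = Ordinal n0.
  by rewrite !inE negbK => /eqP.
have /negbTE Gxy : ~~ G x y by rewrite (v0 x xv) (v0 y yv) adj_irrefl.
by rewrite /= Gxy.
Qed.

End SignlessLaplacian.

Theorem corollary11 (R : rcfType) (n : nat) (G : sgraph 'I_n)
    (Gconn : connected_graph G) (Gniso : no_isolated G) :
  (4 * #|edges G|%:R / n%:R - (vertex_bipartiteness G)%:R
     <= signless_spread R G) /\
  (regular G -> bipartite G ->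
     signless_spread R G
       = 4 * #|edges G|%:R / n%:R - (vertex_bipartiteness G)%:R).
Proof.
have n0 : (0 < n)%N by case: Gconn; rewrite card_ord.
have n0R : 0 < n%:R :> R by rewrite ltr0n.
have Qs := signless_laplacian_sym R G.
have edgeR : \sum_i (degree G i)%:R = 2 * #|edges G|%:R :> R.
  by rewrite -natr_sum handshake natrM.
have q1_ge : 4 * #|edges G|%:R / n%:R <= signless_eigenvalue R G 0.
  pose u : 'rV[R]_n := const_mx 1.
  rewrite ler_pdivrMr //; have /andP[_] := rayleigh_bounds u Qs.
  have -> : (u *m u^T) 0 0 = n%:R.
    by rewrite mulmx_trE (eq_bigr (fun=> 1)) ?sumr_const ?card_ord // => i _; rewrite mxE expr1n.
  apply: le_trans.
  rewrite -(ler_pM2l (ltr0Sn R 1)) signless_formE.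
  (* On the all-ones vector each ordered adjacent pair contributes 4, so the doubled form is
     [8m]. *)
  rewrite (eq_bigr (fun i => (degree G i)%:R * 4)); last first.
    by move=> i _; rewrite degreeE mulr_suml; apply: eq_bigr => j _; rewrite !mxE; ring.
  by rewrite -mulr_suml edgeR; lra.
have qn_le : signless_eigenvalue R G n.-1 <= (vertex_bipartiteness G)%:R.
  have [[S bS cS] _] := vertex_bipartitenessP G.
  have [x xx xQx] := bipartite_form_le R bS.
  have /andP[+ _] := rayleigh_bounds x Qs.
  rewrite xx => /le_trans/(_ xQx); rewrite ler_pM2r cS // ltr0n subn_gt0.
  exact: vertex_bipartiteness_lt.
split; first by apply: lerB.
move=> [d degG] bG.
(* The empty set is already an admissible deletion. *)
have ub0 : vertex_bipartiteness G = 0%N.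
  apply/eqP; rewrite -leqn0 -(cards0 'I_n).
  have [_] := vertex_bipartitenessP G; apply.
  have /existsP[c /forallP cP] := bG.
  apply/existsP; exists [ffun u => c (val u)]; apply/forallP => u; apply/forallP => v.
  by rewrite !ffunE; have /forallP := cP (val u); apply.
(* Evaluating the form at an eigenvector [x] gives the eigenvalue times [|x|^2], which the two
   bounds on the form enclose. *)
have eigen i : (i < n)%N -> 0 <= signless_eigenvalue R G i <= 2 * d%:R.
  move=> ilt; have /eigenvalueP[x xQ x0] := eigenvalues_eigenvalue Qs ilt.
  have xx : 0 < (x *m x^T) 0 0.
    rewrite mulmx_trE lt_def sumr_ge0 ?andbT => [|j _]; last exact: sqr_ge0.
    rewrite psumr_neq0 => [|j _]; last exact: sqr_ge0.
    apply/hasP; have [j xj0] := rV0Pn x x0.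
    by exists j; rewrite ?mem_index_enum //= lt_def sqrf_eq0 xj0 sqr_ge0.
  have E : (x *m signless_laplacian R G *m x^T) 0 0 = signless_eigenvalue R G i * (x *m x^T) 0 0.
    by rewrite xQ -scalemxAl mxE.
  apply/andP; split; first by rewrite -(pmulr_lge0 _ xx) -E signless_form_ge0.
  by rewrite -(ler_pM2r xx) -E; apply: signless_form_le => j; rewrite degG.
(* With constant degree [d], the handshake identity reads [n d = 2m]. *)
have E : 4 * #|edges G|%:R / n%:R = 2 * d%:R :> R.
  have := edgeR; rewrite (eq_bigr (fun=> d%:R)) => [|i _]; last by rewrite degG.
  rewrite sumr_const card_ord -mulr_natr => H.
  by apply: (mulIf (lt0r_neq0 n0R)); rewrite mulfVK ?lt0r_neq0 //; lra.
(* The general bounds now read [2d <= q_1] and [q_n <= 0]; [eigen] supplies the reverse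
   inequalities. *)
rewrite ub0 E /signless_spread in q1_ge qn_le *.
have /andP[q10 q1u] := eigen _ n0.
have /andP[qn0 _] : 0 <= signless_eigenvalue R G n.-1 <= 2 * d%:R by apply: eigen; rewrite prednK.
by congr (_ - _); apply/eqP; rewrite eq_le ?q1_ge ?q1u ?qn0 ?qn_le.
Qed.
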